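(* Let $(G_n=(V_n,E_n))_{n\ge1}$ be a sequence of undirected graphs with partitions $V_n=\sqcup_{i\in I_n}V_n^i$ satisfying conditions (1)–(4) of the context, let $(i_n^* )_{n\ge1}\in\prod_{n\ge1}I_n$, let $V_\infty=\cup_{n\ge1}V_n$, let $(F,d_F)$ be a metric space and let $f:V_\infty\to F$. Let $(\sigma_n)_{n\ge1}$ and $(\sigma_{ref,n})_{n\ge1}$ be $G$-invariant, and let $p\in[1,\infty)$. Suppose that there exists a deterministic $x\in F$ such that, as $n\to\infty$, $$f(\sigma_{ref,n})\xrightarrow{\mathbb{P}}x\quad(\text{resp. } f(\sigma_{ref,n})\xrightarrow{\mathbb{L}^p}x),$$ $$\text{(a)}\quad \underline{\varepsilon}'_{n,Class(\sigma_{ref,n}),\infty}(f)\xrightarrow{\mathbb{P}}0\quad(\text{resp. }\underline{\varepsilon}'_{n,Class(\sigma_{ref,n}),\infty}(f)\xrightarrow{\mathbb{L}^p}0),$$ $$\text{(b)}\quad \underline{\varepsilon}'_{n,Class(\sigma_{n}),\infty}(f)\xrightarrow{\mathbb{P}}0\quad(\text{resp. }\underline{\varepsilon}'_{n,Class(\sigma_{n}),\infty}(f)\xrightarrow{\mathbb{L}^p}0).$$ Then $f(\sigma_n)\xrightarrow{\mathbb{P}}x$ (resp. $f(\sigma_n)\xrightarrow{\mathbb{L}^p}x$). Moreover, if in addition the symmetry condition (5) of the context holds, then (a) and (b) can be replaced by $$\underline{\varepsilon}'_{n,Class(\sigma_{ref,n}),1}(f)\xrightarrow{\mathbb{P}}0\quad(\text{resp.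 }\underline{\varepsilon}'_{n,Class(\sigma_{ref,n}),p}(f)\xrightarrow{\mathbb{L}^p}0)$$ and $$\underline{\varepsilon}'_{n,Class(\sigma_{n}),1}(f)\xrightarrow{\mathbb{P}}0\quad(\text{resp. }\underline{\varepsilon}'_{n,Class(\sigma_{n}),p}(f)\xrightarrow{\mathbb{L}^p}0).$$
   Context: Conditions on the graphs, for every $n\ge1$: (1) $G_n$ is locally finite. (2) There is a countable set $I_n$ and finite sets $(V_n^i)_{i\in I_n}$ with $V_n=\sqcup_{i\in I_n}V_n^i$ (disjoint union). (3) For any $i,j\in I_n$, the number of neighbours in $V_n^j$ of an element of $V_n^i$ is the same for all elements of $V_n^i$; denote it $\mathrm{e}_{i,j}$. (4) The classes graph $\widetilde{G_n}=(I_n,\widetilde{E_n})$, with $\widetilde{E_n}=\{(i,j)\in I_n^2:\mathrm{e}_{i,j}>0\}$, is connected. For $\sigma\in V_n$, $Class(\sigma)$ is the unique $i\in I_n$ with $\sigma\in V_n^i$. With $d_{G_n}$ the graph distance, $\underline d(\sigma):=\min_{\rho\in V_n^{i_n^*}}d_{G_n}(\sigma,\rho)$. Let $G'_n=(V_n,E'_n)$ be the directed graph with $E'_n=\{(\sigma_1,\sigma_2)\in E_n:\underline d(\sigma_2)=\underline d(\sigma_1)-1\}\cup\{(\sigma,\sigma):\sigma\in V_n^{i_n^*}\}$. For $S\subset V_n$, $\mathrm{next}(S):=\{\sigma_2:\sigma_1\in S,\ (\sigma_1,\sigma_2)\in E'_n\}$; $\mathrm{final}(\sigma):=\mathrm{next}^{\underline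 d(\sigma)}(\{\sigma\})$ if $\underline d(\sigma)\ge1$ and $\mathrm{final}(\sigma):=\{\sigma\}$ otherwise. For $i\in I_n$ and $p\in[1,\infty)$, $$\underline{\varepsilon}'_{n,i,p}(f):=\Big(\sum_{\sigma\in V_n^i}\sum_{\rho\in\mathrm{final}(\sigma)}\frac{d_F(f(\sigma),f(\rho))^p}{\mathrm{card}(V_n^i)\,\mathrm{card}(\mathrm{final}(\sigma))}\Big)^{1/p},\qquad \underline{\varepsilon}'_{n,i,\infty}(f):=\max_{\sigma\in V_n^i}\max_{\rho\in\mathrm{final}(\sigma)}d_F(f(\sigma),f(\rho)).$$ (5) Symmetry condition: for every $n$ and $\sigma_1\in V_n$, the number of paths in $G'_n$ of length $\underline d(\sigma_1)$ from $\sigma_1$ to $\sigma_2$ is the same for all $\sigma_2\in\mathrm{final}(\sigma_1)$. A sequence $(\sigma_n)_{n\ge1}$ of random variables, $\sigma_n$ taking values in $V_n$, is $G$-invariant if for every $n\ge1$, every $i\in I_n$ and all $\sigma,\rho\in V_n^i$, $\mathbb{P}(\sigma_n=\sigma)=\mathbb{P}(\sigma_n=\rho)$. For $F$-valued variables, $Y_n\to x$ in probability (resp. in $\mathbb{L}^p$) means that $d_F(Y_n,x)\to0$ in probability (resp. in $\mathbb{L}^p$). *)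

(* Defs.v *)
From HB Require Import structures.
From mathcomp Require Import all_boot all_order all_algebra finmap.
From mathcomp Require Import all_classical all_reals all_analysis.
Import Order.TTheory GRing.Theory Num.Theory.

Set Implicit Arguments.
Unset Strict Implicit.
Unset Printing Implicit Defensive.

Local Open Scope classical_set_scope.
Local Open Scope ring_scope.

(* Only meaningful for finite sets: the value is 0 on infinite ones. *)
Definition ncard (T : choiceType) (A : set T) : nat := #|` fset_set A|%fset.

(* The vertex sets of the different graphs of a sequence are subsets of one
   ambient type [T] and may overlap. *)
Record class_graph (T : choiceType) := ClassGraph {
  vert : set T ;
  edge : rel T ;
  cls : countType ;
  cell : cls -> set T
}.

Arguments vert {T} c.
Arguments edge {T} c.
Arguments cls {T} c.
Arguments cell {T} {c}.

Section graph.
Variables (T : choiceType) (G : class_graph T).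

Definition undirected : Prop :=
  symmetric (edge G) /\ forall u v, edge G u v -> vert G u /\ vert G v.

Definition locally_finite : Prop :=
  forall u, vert G u -> finite_set [set v | edge G u v].

(* [partition] includes that no cell is empty. *)
Definition finite_cells : Prop :=
  partition [set: cls G] (@cell T G) (vert G) /\
  forall i : cls G, finite_set (cell i).

Definition class_degrees (e : cls G -> cls G -> nat) : Prop :=
  forall (i j : cls G) (u : T), cell i u ->
    ncard [set v | edge G u v /\ cell j v] = e i j.

Definition rel_connected (I : Type) (r : rel I) : Prop :=
  forall i j : I, exists2 s : seq I, path r i s & last i s = j.

(* The matrix [e] is uniquely determined, since the cells are not empty. *)
Definition admissible : Prop :=
  [/\ undirected, locally_finite, finite_cells &
    exists2 e : cls G -> cls G -> nat, class_degrees e &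
      rel_connected [rel i j | (0 < e i j)%N]].

(* A walk from [u] is the sequence of its vertices after [u], so that its
   length is the size of the sequence. *)
Definition walks (r : rel T) (u v : T) : set (seq T) :=
  [set s | path r u s /\ last u s = v].

Definition gdist (u v : T) : nat :=
  infimum 0%N [set size s | s in walks (edge G) u v].

Variable o : cls G.

(* The default value [o] is irrelevant when [u] is a vertex. *)
Definition Class (u : T) : cls G := xget o [set i | cell i u].

(* [G] itself need not be connected: vertices of the reference cell in another
   component are at infinite distance and do not contribute to the minimum. *)
Definition udist (u : T) : nat :=
  infimum 0%N [set gdist u v | v in
    [set v | cell o v /\ walks (edge G) u v !=set0]].

(* [udist v = udist u - 1] is an equality of integers. *)
Definition dedge : rel T := fun u v =>
  (edge G u v && (udist u == (udist v).+1)) || ((u == v) && `[< cell o u >]).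

Definition next (S : set T) : set T :=
  [set v | exists2 u, S u & dedge u v].

Definition final (u : T) : set T :=
  if (0 < udist u)%N then iter (udist u) next [set u] else [set u].

Definition dpaths (u v : T) (k : nat) : set (seq T) :=
  [set s | walks dedge u v s /\ size s = k].

Definition symmetry_condition : Prop :=
  forall u, vert G u -> forall v w, final u v -> final u w ->
    ncard (dpaths u v (udist u)) = ncard (dpaths u w (udist u)).

Variables (R : realType) (F : metricType R) (f : T -> F).

Definition eps (i : cls G) (p : R) : R :=
  (\sum_(u <- fset_set (cell i)) \sum_(v <- fset_set (final u))
     mdist (f u) (f v) `^ p / ((ncard (cell i))%:R * (ncard (final u))%:R))
  `^ p^-1.

(* Distances are nonnegative, so that the neutral element 0 does not affect
   these maxima over nonempty finite sets. *)
Definition eps_oo (i : cls G) : R :=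
  \big[Num.max/0]_(u <- fset_set (cell i))
    \big[Num.max/0]_(v <- fset_set (final u)) mdist (f u) (f v).

End graph.

Section random.
Context d (Omega : measurableType d) (R : realType) (P : probability Omega R).

(* Measurability for the discrete sigma-algebra. *)
Definition random_vertex (T : choiceType) (G : class_graph T)
    (X : Omega -> T) : Prop :=
  (forall w, vert G (X w)) /\ forall A : set T, measurable (X @^-1` A).

Definition G_invariant (T : choiceType) (G : class_graph T)
    (X : Omega -> T) : Prop :=
  forall (i : cls G) (u v : T), cell i u -> cell i v ->
    P (X @^-1` [set u]) = P (X @^-1` [set v]).

(* Sequences are indexed by [n >= 1]; the term of index 0 is irrelevant. *)
Definition cvg0_prob (Z : nat -> Omega -> R) : Prop :=
  forall e : R, 0 < e ->
    P [set w | e < `|Z n w|] @[n --> \oo] --> (0 : \bar R).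

Definition cvg0_Lp (p : R) (Z : nat -> Omega -> R) : Prop :=
  (forall n, (0 < n)%N -> Z n \in Lfun P p%:E) /\
  'N[P]_p%:E[EFin \o Z n]%E @[n --> \oo] --> (0 : \bar R).

Definition cvg_prob (F : metricType R) (Y : nat -> Omega -> F) (x : F) : Prop :=
  cvg0_prob (fun n w => mdist (Y n w) x).

Definition cvg_Lp (p : R) (F : metricType R) (Y : nat -> Omega -> F)
    (x : F) : Prop :=
  cvg0_Lp p (fun n w => mdist (Y n w) x).

End random.

(* Main.v *)
Require Import Defs.
From HB Require Import structures.
From mathcomp Require Import all_boot all_order all_algebra finmap.
From mathcomp Require Import all_classical all_reals all_analysis.
From mathcomp Require Import measurable_realfun.
Import Order.TTheory GRing.Theory Num.Theory.
Local Open Scope classical_set_scope.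
Local Open Scope ring_scope.

(** The reference cell carries all the information: the proof compares the law
    of [f(sigma)] with the uniform law on the reference cell [o], twice.

    Fix one graph and a cell [i]. All vertices of [i] lie at the same distance
    [k] from [o], and a walk of length [k] from [u] in [i] to [o] is the same
    thing as a path of length [k] in the graph directed towards [o]. Let
    [nwalk k u v] count the walks of length [k] from [u] to [v]. Its sum over
    [v] in a given cell depends only on the cell of [u] ([nwalk_class]), because
    the numbers of neighbours do; and it is symmetric in [u] and [v]
    ([nwalkC]), because the graph is undirected. Hence the matrix with rows in
    [i] and columns in [o] has constant row sums and constant column sums: once
    its rows are normalised into probabilities [kern u], it carries the uniform
    law on [i] to the uniform law on [o] ([avg_kern]). Moreover [kern u] charges
    only [final u], and it is uniform on [final u] under the symmetry condition
    ([kern_mean_sym]). This is a coupling of a uniform vertex of [i] with a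
    uniform vertex of [o] in which the values of [f] differ by at most
    [eps_oo i], and by [eps i p] in p-th mean under the symmetry condition.

    By invariance, a random vertex is uniform on its cell given that cell, so
    two functions of it can be compared through their averages over each cell
    ([le_integral_avg]). The coupling for the cell of [sigma_ref] shows that [f]
    is close to [x] at a uniform vertex of [o]; the coupling for the cell of
    [sigma] then shows that [f(sigma)] is close to [x].

    Both modes of convergence are treated at once: [Z_n] tends to 0 in
    probability, respectively in L^p, iff the mean of [h(Z_n)] tends to 0, with
    [h t = min 1 t], respectively [h t = t^p] ([cvg0_probP], [cvg0_LpP]). Both
    functions [h] are nondecreasing and subadditive up to a constant factor,
    which replaces the triangle inequality for the mode of convergence
    ([gauge], [avg_source_le], [avg_target_le]). *)

Set Implicit Arguments.
Unset Strict Implicit.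

(** * Walks and the distance to the reference cell *)

Lemma ncard_uniq (T : choiceType) (A : set T) (s : seq T) :
  uniq s -> (forall x, A x <-> x \in s) -> ncard A = size s.
Proof.
move=> us As.
have finA : finite_set A.
  have -> : A = [set` s] by apply/seteqP; split => x /= /As.
  exact: finite_seq.
rewrite /ncard; apply: perm_size; apply: uniq_perm; rewrite ?fset_uniq// => x.
by rewrite in_fset_set//; apply/idP/idP => [/set_mem/As|/As/mem_set].
Qed.

Lemma infimum_natE (A : set nat) m :
  A m -> (forall k, A k -> (m <= k)%N) -> infimum 0%N A = m.
Proof.
move=> Am mA; rewrite /infimum ifF; last first.
  by apply/negbTE/eqP => A0; rewrite A0 in Am.
have lbm : lbound A m by move=> k /mA; rewrite leEnat.
apply: xget_unique; first by split => // k /(_ _ Am).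
by move=> k [lbk ubk]; apply/le_anti; rewrite lbk //= ubk.
Qed.

Lemma nat_set_min (A : set nat) : A !=set0 ->
  exists2 m, A m & forall k, A k -> (m <= k)%N.
Proof.
move=> [k Ak]; have ex : exists k, `[< A k >] by exists k; apply/asboolP.
case: (ex_minnP ex) => m /asboolP Am mP.
by exists m => // l /asboolP/mP.
Qed.

Section graph.
Variables (T : choiceType) (G : class_graph T) (hG : admissible G).
Implicit Types (u v w : T) (i j : cls G).

Lemma edgeC : symmetric (edge G).
Proof. by case: hG => -[]. Qed.

Lemma edge_vert u v : edge G u v -> vert G u /\ vert G v.
Proof. by case: hG => -[_ h] _ _ _ /h. Qed.

Lemma cell_fin i : finite_set (cell i).
Proof. by case: hG => _ _ []. Qed.

Lemma cell_nonempty i : cell i !=set0.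
Proof. by case: hG => _ _ [[_ _ /(_ i I)]]. Qed.

Lemma cell_vert i u : cell i u -> vert G u.
Proof. by move=> iu; case: hG => _ _ [[<- _ _] _] _; exists i. Qed.

Lemma vert_cell u : vert G u -> exists i, cell i u.
Proof. by case: hG => _ _ [[<- _ _] _] _ [i _ iu]; exists i. Qed.

Lemma cell_inj i j u : cell i u -> cell j u -> i = j.
Proof.
by move=> iu ju; case: hG => _ _ [[_ tI _] _] _; apply: tI => //; exists u.
Qed.

Definition neighbours u := fset_set [set v | edge G u v].

Lemma mem_neighbours u v : (v \in neighbours u) = edge G u v.
Proof.
have fin : finite_set [set v | edge G u v].
  have [uV|uV] := pselect (vert G u); first by case: hG => _ /(_ _ uV).
  suff -> : [set v | edge G u v] = set0 by exact: finite_set0.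
  by apply/seteqP; split => // w /= /edge_vert[].
by rewrite in_fset_set//; apply/idP/idP => [/set_mem|/mem_set].
Qed.

Definition cell_fset i := fset_set (cell i).

Lemma mem_cell_fset i u : (u \in cell_fset i) <-> cell i u.
Proof.
by rewrite in_fset_set; [split => [/set_mem|/mem_set]|exact: cell_fin].
Qed.

Lemma cell_fset_gt0 i : (0 < size (cell_fset i))%N.
Proof.
have [u /mem_cell_fset iu] := cell_nonempty i.
by rewrite -has_predT; apply/hasP; exists u.
Qed.

Lemma Class_cellE o i u : cell i u -> Class o u = i.
Proof. by move=> iu; apply: xget_unique => // j /cell_inj/(_ iu). Qed.

Fixpoint nwalk k u v : nat :=
  if k is k'.+1 then \sum_(w <- neighbours u) nwalk k' w v else (u == v).

(** The recursion at the other end of the walk: once it is known, the symmetry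
    of [nwalk] in its endpoints is an induction. *)
Lemma nwalkSr k u v : nwalk k.+1 u v = (\sum_(w <- neighbours v) nwalk k u w)%N.
Proof.
elim: k u v => [|k ih] u v; last first.
  transitivity (\sum_(w <- neighbours u) \sum_(z <- neighbours v) nwalk k w z)%N.
    by apply: eq_bigr => w _; rewrite -ih.
  by rewrite exchange_big.
(* Both sides of the base case are the adjacency of [u] and [v]. *)
have E u' v' : (\sum_(w <- neighbours u') (w == v') = edge G u' v')%N.
  rewrite -big_mkcond/= big_const_seq iter_addn_0 mul1n -mem_neighbours.
  by rewrite (count_uniq_mem v' (fset_uniq (neighbours u'))).
rewrite /= E edgeC -E; apply: eq_bigr => w _.
by rewrite eq_sym.
Qed.

Lemma nwalkC k u v : nwalk k u v = nwalk k v u.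
Proof.
elim: k u v => [|k ih] u v; first by rewrite /= eq_sym.
by rewrite nwalkSr /=; apply: eq_bigr => w _.
Qed.

(** An explicit enumeration ties the recursive count to the cardinals of the sets
    of walks, in which the symmetry condition is expressed. *)
Fixpoint walk_seq k u v : seq (seq T) :=
  if k is k'.+1 then [seq w :: s | w <- neighbours u, s <- walk_seq k' w v]
  else if u == v then [:: [::]] else [::].

Lemma size_walk_seq k u v : size (walk_seq k u v) = nwalk k u v.
Proof.
elim: k u => [|k ih] u /=; first by case: eqP.
by rewrite size_allpairs_dep sumnE big_map; apply: eq_bigr => w _.
Qed.

Lemma walk_seq_uniq k u v : uniq (walk_seq k u v).
Proof.
elim: k u => [|k ih] u /=; first by case: eqP.
apply: allpairs_uniq_dep => [|w _|]; [exact: fset_uniq|exact: ih|].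
by move=> [w s] [w' s'] _ _ /= [-> ->].
Qed.

Lemma walk_seqP k u v s :
  s \in walk_seq k u v <-> walks (edge G) u v s /\ size s = k.
Proof.
elim: k u s => [|k ih] u s /=.
  split; first by case: eqP => // ->; rewrite inE => /eqP ->.
  by case=> -[_ +] /size0nil s0; rewrite s0 /= => ->; rewrite eqxx inE.
split => [/allpairsPdep/=[w [s' [wu /ih[[ps ls] <-] ->]]]|].
  by rewrite mem_neighbours in wu; rewrite /walks /= wu ps.
case: s => [|w s]/= [[]]// /andP[uw ps] ls [ss].
by apply/allpairsPdep; exists w, s; split; [rewrite mem_neighbours|apply/ih|].
Qed.

Lemma ncard_walks k u v :
  ncard [set s | walks (edge G) u v s /\ size s = k] = nwalk k u v.
Proof.
rewrite -size_walk_seq; apply: ncard_uniq; first exact: walk_seq_uniq.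
by move=> s; rewrite walk_seqP.
Qed.

Lemma nwalk_gt0 k u v : (0 < nwalk k u v)%N <->
  exists2 s, walks (edge G) u v s & size s = k.
Proof.
rewrite -size_walk_seq; split => [|[s ws sk]].
  case E: (walk_seq k u v) => [//|s r] _.
  have /walk_seqP[ws sk] : s \in walk_seq k u v by rewrite E mem_head.
  by exists s.
have : s \in walk_seq k u v by apply/walk_seqP.
by case: walk_seq.
Qed.

(** The multiset of the cells of the neighbours of [u] is determined by the cell
    of [u], since the multiplicity of [j] in it is the degree towards [j]. *)
Lemma sum_neighbours_class (g : T -> nat) :
  (forall i u v, cell i u -> cell i v -> g u = g v) ->
  forall i u v, cell i u -> cell i v ->
    (\sum_(w <- neighbours u) g w = \sum_(w <- neighbours v) g w)%N.
Proof.
move=> gE i u v iu iv.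
(* A class function factors through a choice of one vertex in each cell. *)
pose rep j := xget u (@cell T G j).
have gC w : vert G w -> g w = g (rep (Class i w)).
  move=> /vert_cell[j jw]; rewrite (Class_cellE _ jw); apply: (gE j) => //.
  exact: (xgetI _ jw).
have sumE x : (\sum_(w <- neighbours x) g w =
    \sum_(j <- [seq Class i w | w <- neighbours x]) g (rep j))%N.
  rewrite big_map; apply: eq_big_seq => w.
  by rewrite mem_neighbours => /edge_vert[_ /gC].
rewrite !sumE; apply: perm_big; apply/allP => j _ /=; apply/eqP.
case: hG => _ _ _ [e he _].
suff cE x : cell i x -> count_mem j [seq Class i w | w <- neighbours x] = e i j.
  by rewrite !cE.
move=> ix; rewrite -(he i j x ix) count_map -size_filter; apply/esym.
apply: ncard_uniq; first by rewrite filter_uniq// fset_uniq.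
move=> w; rewrite mem_filter /= mem_neighbours.
split => [[xw jw]|/andP[/eqP <- xw]].
  by rewrite (Class_cellE _ jw) eqxx.
split=> //; have [_ /vert_cell[l lw]] := edge_vert xw.
by rewrite (Class_cellE _ lw).
Qed.

(** Summing over the first step, an induction on the length: the inner sums are
    class functions, to which [sum_neighbours_class] applies. *)
Lemma nwalk_class k i j u v : cell i u -> cell i v ->
  (\sum_(w <- cell_fset j) nwalk k u w = \sum_(w <- cell_fset j) nwalk k v w)%N.
Proof.
elim: k i u v => [|k ih] i u v iu iv /=.
  have E x : (\sum_(w <- cell_fset j) (x == w) = (x \in cell_fset j))%N.
    rewrite -big_mkcond/= big_const_seq iter_addn_0 mul1n.
    rewrite -(count_uniq_mem x (fset_uniq (cell_fset j))).
    by apply: eq_count => y; rewrite /= eq_sym.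
  rewrite !E; congr nat_of_bool.
  apply/idP/idP => /mem_cell_fset h; apply/mem_cell_fset.
    by rewrite (cell_inj h iu).
  by rewrite (cell_inj h iv).
rewrite exchange_big [RHS]exchange_big/=.
exact: sum_neighbours_class ih _ _ _ iu iv.
Qed.

Section target.
Variable o : cls G.

Lemma walk_to_target u : vert G u ->
  exists2 s, path (edge G) u s & cell o (last u s).
Proof.
move=> /vert_cell[i]; case: hG => _ _ _ [e he conn].
have [c pc lc] := conn i o.
elim: c i u pc lc => [|j c ih] i u /=; first by move=> _ <-; exists [::].
move=> /andP[eij pc] lc iu.
have [w uw jw] : exists2 w, edge G u w & cell j w.
  apply/not_exists2P => no; move: eij; rewrite -(he _ _ _ iu).
  suff -> : [set v | edge G u v /\ cell j v] = set0.
    by rewrite /ncard fset_set0 cardfs0.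
  by apply/seteqP; split => // v [uv jv]; have [] := no v.
by have [s ps ls] := ih _ _ pc lc jw; exists (w :: s); rewrite //= uw.
Qed.

Lemma gdist_min u v : walks (edge G) u v !=set0 ->
  (exists2 s, walks (edge G) u v s & size s = gdist G u v) /\
  (forall s, walks (edge G) u v s -> (gdist G u v <= size s)%N).
Proof.
move=> [s ws].
have [|m Am mP] := @nat_set_min [set size s | s in walks (edge G) u v].
  by exists (size s), s.
rewrite /gdist (infimum_natE Am mP); split; first by case: Am => t; exists t.
by move=> t wt; apply: mP; exists t.
Qed.

(** The nested infima defining [udist] amount to the least length of a walk to
    the reference cell; connectedness of the graph of classes makes this set of
    lengths nonempty, so that no default value is used. *)
Lemma udist_min u : vert G u ->
  (exists s, [/\ path (edge G) u s, cell o (last u s) & size s = udist o u]) /\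
  (forall s, path (edge G) u s -> cell o (last u s) -> (udist o u <= size s)%N).
Proof.
move=> uV; have [s ps ls] := walk_to_target uV.
set A := [set gdist G u v | v in
    [set v | cell o v /\ walks (edge G) u v !=set0]].
have Awalk t : path (edge G) u t -> cell o (last u t) ->
    exists2 k, A k & (k <= size t)%N.
  move=> pt lt; have wt : walks (edge G) u (last u t) t by [].
  exists (gdist G u (last u t)).
    by exists (last u t) => //; split => //; exists t.
  by apply: (gdist_min _).2 => //; exists t.
have [|m Am mP] := @nat_set_min A.
  by have [k Ak _] := Awalk _ ps ls; exists k.
rewrite /udist (infimum_natE Am mP); split; last first.
  by move=> t pt lt; have [k /mP mk] := Awalk _ pt lt; apply: leq_trans.
case: Am => v [ov wuv] <-; have [[t [pt lt] <-] _] := gdist_min wuv.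
by exists t; rewrite lt.
Qed.

Lemma udist0 u : vert G u -> udist o u = 0%N -> cell o u.
Proof.
by move=> /udist_min[[s [_ os +]] _] => <- /size0nil s0; rewrite s0 in os.
Qed.

Lemma cell_udist0 u : cell o u -> udist o u = 0%N.
Proof.
move=> ou; have [_ /(_ [::] isT ou)] := udist_min (cell_vert ou).
by rewrite leqn0 => /eqP.
Qed.

(** A walk of length [k] to [o] exists iff the sum of [nwalk k u] over [o] is
    positive, and that sum depends only on the cell of [u]. *)
Lemma udist_class i u v : cell i u -> cell i v -> udist o u = udist o v.
Proof.
have le u' v' : cell i u' -> cell i v' -> (udist o v' <= udist o u')%N.
  move=> iu iv; have [[s [ps os su]] _] := udist_min (cell_vert iu).
  have [_ vP] := udist_min (cell_vert iv).
  have : (0 < \sum_(w <- cell_fset o) nwalk (udist o u') v' w)%N.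
    rewrite -(nwalk_class _ _ iu iv) (big_rem (last u' s)) /=;
      last exact/mem_cell_fset.
    by rewrite ltn_addr//; apply/nwalk_gt0; exists s.
  rewrite lt0n; apply: contraTT; rewrite -ltnNge => uv.
  rewrite negbK sum_nat_seq_eq0; apply/allP => w /mem_cell_fset ow /=.
  rewrite -leqn0 leqNgt.
  apply: contraTN uv => /nwalk_gt0[t [pt lt] <-].
  by rewrite -leqNgt vP// lt.
by move=> iu iv; apply/eqP; rewrite eqn_leq !le.
Qed.

(** In [udist u] steps from [u] to the reference cell there is no step to waste:
    each one decreases the distance by one, and the loops at the reference cell
    are never used. *)
Lemma dpathP u s : vert G u -> size s = udist o u ->
  path (dedge o) u s <-> path (edge G) u s /\ cell o (last u s).
Proof.
elim: s u => [|w s ih] u uV /=.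
  by move=> /esym/(udist0 uV) ou; split.
move=> su; rewrite {1}/dedge (_ : `[< cell o u >] = false) ?andbF ?orbF; last first.
  by apply/negbTE/asboolPn => /cell_udist0 u0; rewrite u0 in su.
split => [/andP[/andP[uw /eqP]]|[/andP[uw ps] os]].
  rewrite -su => -[sw]; rewrite uw /=; have [_ wV] := edge_vert uw.
  exact: (ih w wV sw).1.
have [_ wV] := edge_vert uw.
have sw : size s = udist o w.
  apply/eqP; rewrite eqn_leq; have [[t [pt ot tw]] wP] := udist_min wV.
  rewrite wP// andbT -tw -ltnS su.
  by apply: ((udist_min uV).2 (w :: t)); rewrite //= uw.
by rewrite uw -su sw eqxx /=; apply/(ih w).
Qed.

Lemma iter_next k (S : set T) v : iter k (Defs.next o) S v <->
  exists u s, [/\ S u, path (dedge o) u s, size s = k & last u s = v].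
Proof.
elim: k v => [|k ih] v /=.
  split=> [Sv|[u [s [Su _ /size0nil -> <-]]]//].
  by exists v, [::].
split=> [[w /ih[u [s [Su ps sk lw]]] wv]|[u [s]]].
  by exists u, (rcons s v); rewrite rcons_path ps lw last_rcons size_rcons sk.
case/lastP: s => [|s w] [Su]//; rewrite rcons_path last_rcons size_rcons.
move=> /andP[ps lw] [sk] <-; exists (last u s) => //.
by apply/ih; exists u, s.
Qed.

Lemma finalP u v : vert G u ->
  final o u v <-> cell o v /\ (0 < nwalk (udist o u) u v)%N.
Proof.
move=> uV.
have -> : final o u = iter (udist o u) (Defs.next o) [set u].
  by rewrite /final; case: udist.
rewrite iter_next nwalk_gt0; split.
  by case=> _ [s [-> + su <-]] => /(dpathP uV su)[ps os]; split => //; exists s.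
by case=> ov [s [ps lv] su]; exists u, s; split => //; apply/dpathP; rewrite ?lv.
Qed.

Lemma final_cell u v : vert G u -> final o u v -> cell o v.
Proof. by move=> uV /(finalP _ uV)[]. Qed.

Lemma final_fin u : vert G u -> finite_set (final o u).
Proof.
by move=> uV; apply: sub_finite_set (cell_fin o) => v /(final_cell uV).
Qed.

Lemma ncard_dpaths u v : vert G u -> cell o v ->
  ncard (dpaths o u v (udist o u)) = nwalk (udist o u) u v.
Proof.
move=> uV ov; rewrite -ncard_walks; congr ncard; apply/seteqP.
split=> s [[ps lv] su]; split => //; split => //.
  by have [] := (dpathP uV su).1 ps.
by apply/dpathP; rewrite ?lv.
Qed.

End target.
End graph.

(** * The doubly stochastic kernel between two cells *)

Section average.
Variables (T : choiceType) (G : class_graph T) (hG : admissible G) (R : realType).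
Implicit Types (i : cls G) (g : T -> R).

Definition avg i g : R :=
  (\sum_(u <- cell_fset i) g u) / (size (cell_fset i))%:R.

Lemma size_cell_fset_gt0 i : 0 < (size (cell_fset i))%:R :> R.
Proof. by rewrite ltr0n cell_fset_gt0. Qed.

Lemma le_avg i g g' : (forall u, cell i u -> g u <= g' u) -> avg i g <= avg i g'.
Proof.
move=> gg'; rewrite /avg ler_pM2r ?invr_gt0 ?size_cell_fset_gt0//.
rewrite big_seq [leRHS]big_seq.
by apply: ler_sum => u /(mem_cell_fset hG)/gg'.
Qed.

Lemma eq_avg i g g' : (forall u, cell i u -> g u = g' u) -> avg i g = avg i g'.
Proof. by move=> gg'; apply/le_anti; rewrite !le_avg// => u /gg' ->. Qed.

Lemma avg_cst i (a : R) : avg i (fun=> a) = a.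
Proof.
rewrite /avg big_const_seq count_predT iter_addr_0 -[a *+ _]mulr_natr mulfK//.
by rewrite gt_eqF// size_cell_fset_gt0.
Qed.

Lemma avgD i g g' : avg i (fun u => g u + g' u) = avg i g + avg i g'.
Proof. by rewrite /avg big_split mulrDl. Qed.

Lemma avgZ i (a : R) g : avg i (fun u => a * g u) = a * avg i g.
Proof. by rewrite /avg -mulr_sumr mulrA. Qed.

Lemma avg_ge0 i g : (forall u, 0 <= g u) -> 0 <= avg i g.
Proof.
by move=> g0; rewrite -(avg_cst i 0) le_avg.
Qed.

End average.

Section kernel.
Variables (T : choiceType) (G : class_graph T) (hG : admissible G) (o : cls G).
Variable (R : realType).
Implicit Types (i : cls G) (u v : T).

(** The law of the endpoint of a uniform random walk among the walks of length
    [udist o u] from [u] to the reference cell. *)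
Definition kern u v : R := (nwalk G (udist o u) u v)%:R /
  (\sum_(w <- cell_fset o) nwalk G (udist o u) u w)%:R.

Definition kern_mean u (g : T -> R) := \sum_(v <- cell_fset o) kern u v * g v.

Lemma kern_ge0 u v : 0 <= kern u v.
Proof. by rewrite divr_ge0. Qed.

Lemma row_gt0 u : vert G u ->
  (0 < \sum_(w <- cell_fset o) nwalk G (udist o u) u w)%N.
Proof.
move=> uV; have [[s [ps os su]] _] := udist_min hG o uV.
rewrite (big_rem (last u s)) /=; last exact/mem_cell_fset.
by rewrite ltn_addr//; apply/nwalk_gt0 => //; exists s.
Qed.

Lemma kern_sum u : vert G u -> \sum_(v <- cell_fset o) kern u v = 1.
Proof.
move=> uV; rewrite /kern -mulr_suml -natr_sum divff//.
by rewrite pnatr_eq0 -lt0n row_gt0.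
Qed.

Lemma kern_eq0 u v : vert G u -> cell o v -> ~ final o u v -> kern u v = 0.
Proof.
move=> uV ov nf; rewrite /kern (_ : nwalk _ _ _ _ = 0%N) ?mul0r//.
by apply/eqP; rewrite -leqn0 leqNgt; apply/negP => h; apply: nf; apply/finalP.
Qed.

(** The matrix [nwalk k] between the cells [i] and [o] has constant row sums [r]
    and constant column sums [c], by symmetry of [nwalk]. Counting its entries
    in two ways gives [|o| c = |i| r], so that each column of [kern] sums to
    [|i| / |o|]: the uniform law on [i] is carried to the uniform law on [o]. *)
Lemma avg_kern i (g : T -> R) : avg i (kern_mean ^~ g) = avg o g.
Proof.
have [u0 iu0] := cell_nonempty hG i.
pose k := udist o u0.
pose r := (\sum_(w <- cell_fset o) nwalk G k u0 w)%N.
have r0 : r%:R != 0 :> R.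
  by rewrite pnatr_eq0 -lt0n row_gt0//; apply: cell_vert iu0.
have kernE u v : cell i u -> kern u v = (nwalk G k u v)%:R / r%:R.
  move=> iu; rewrite /kern (udist_class hG o iu iu0) -/k.
  by rewrite (nwalk_class hG k o iu iu0).
have [v0 ov0] := cell_nonempty hG o.
pose c := (\sum_(u <- cell_fset i) nwalk G k v0 u)%N.
have colE v : cell o v -> (\sum_(u <- cell_fset i) nwalk G k u v = c)%N.
  move=> ov; rewrite /c -(nwalk_class hG k i ov ov0).
  by apply: eq_bigr => u _; rewrite nwalkC.
have rowE u : cell i u -> (\sum_(v <- cell_fset o) nwalk G k u v = r)%N.
  by move=> iu; rewrite /r (nwalk_class hG k o iu iu0).
have crE : ((size (cell_fset o))%:R * c%:R = (size (cell_fset i))%:R * r%:R :> R).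
  rewrite -!natrM; congr (_%:R).
  transitivity (\sum_(v <- cell_fset o) \sum_(u <- cell_fset i) nwalk G k u v)%N.
    rewrite big_seq (eq_bigr (fun=> c)) => [|v /(mem_cell_fset hG)/colE//].
    by rewrite -big_seq big_const_seq count_predT iter_addn_0 mulnC.
  rewrite exchange_big big_seq.
  rewrite (eq_bigr (fun=> r)) => [|u /(mem_cell_fset hG)/rowE//].
  by rewrite -big_seq big_const_seq count_predT iter_addn_0 mulnC.
have i0 := size_cell_fset_gt0 hG R i; have o0 := size_cell_fset_gt0 hG R o.
rewrite /avg /kern_mean exchange_big /=.
rewrite big_seq (eq_bigr (fun v => c%:R / r%:R * g v)); last first.
  move=> v /(mem_cell_fset hG)/colE <-; rewrite -mulr_suml; congr (_ * _).
  rewrite natr_sum mulr_suml big_seq [RHS]big_seq; apply: eq_bigr => u.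
  by move=> /(mem_cell_fset hG) iu; rewrite kernE.
rewrite -big_seq -mulr_sumr mulrAC [RHS]mulrC; congr (_ * _).
apply: (mulfI (lt0r_neq0 o0)); rewrite mulfV ?(lt0r_neq0 o0)// !mulrA crE.
by rewrite mulfK// mulfV// (lt0r_neq0 i0).
Qed.

Lemma le_kern_mean u (g g' : T -> R) : vert G u ->
  (forall v, final o u v -> g v <= g' v) -> kern_mean u g <= kern_mean u g'.
Proof.
move=> uV gg'; rewrite /kern_mean big_seq [leRHS]big_seq.
apply: ler_sum => v /(mem_cell_fset hG) ov.
have [fv|nfv] := pselect (final o u v).
  by rewrite ler_wpM2l ?kern_ge0 ?gg'.
by rewrite kern_eq0// !mul0r.
Qed.

Lemma kern_mean_cst u (a : R) : vert G u -> kern_mean u (fun=> a) = a.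
Proof. by move=> uV; rewrite /kern_mean -mulr_suml kern_sum// mul1r. Qed.

Lemma kern_meanD u (g g' : T -> R) :
  kern_mean u (fun v => g v + g' v) = kern_mean u g + kern_mean u g'.
Proof.
by rewrite /kern_mean -big_split; apply: eq_bigr => v _; rewrite mulrDr.
Qed.

Lemma kern_meanZ u a (g : T -> R) :
  kern_mean u (fun v => a * g v) = a * kern_mean u g.
Proof.
by rewrite /kern_mean mulr_sumr; apply: eq_bigr => v _; rewrite mulrCA.
Qed.

Lemma mem_final u v : vert G u -> (v \in fset_set (final o u)) <-> final o u v.
Proof.
move=> uV; rewrite in_fset_set; last exact: final_fin.
by split => [/set_mem|/mem_set].
Qed.

(** The symmetry condition says that all the positive entries of the row [u] of
    [nwalk] are equal, so that the normalised row is uniform on [final u]. *)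
Lemma kern_mean_sym u (g : T -> R) : symmetry_condition o -> vert G u ->
  kern_mean u g =
  (\sum_(v <- fset_set (final o u)) g v) / (ncard (final o u))%:R.
Proof.
move=> sym uV; set F := fset_set (final o u).
have sumF (g' : T -> R) :
    \sum_(v <- cell_fset o) (v \in F)%:R * g' v = \sum_(v <- F) g' v.
  transitivity (\sum_(v <- cell_fset o | v \in F) g' v).
    rewrite [RHS]big_mkcond; apply: eq_bigr => v _.
    by case: ifP => _; rewrite ?mul1r ?mul0r.
  rewrite -big_filter; apply: perm_big; apply: uniq_perm.
  - by rewrite filter_uniq ?fset_uniq.
  - exact: fset_uniq.
  move=> v; rewrite mem_filter; apply/andP/idP => [[]//|vF]; split => //.
  by apply/mem_cell_fset => //; apply: (final_cell hG uV); apply/mem_final.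
pose k := udist o u.
(* [m] is the common value on [final u], and any number if it is empty. *)
have [m mE] : exists m, forall v, cell o v ->
    nwalk G k u v = ((v \in F) * m)%N.
  have [v0 /mem_cell_fset ov0] := cell_nonempty hG o.
  have [[w fw]|nw] := pselect (exists w, final o u w); last first.
    exists 0%N => v ov; rewrite muln0; apply/eqP; rewrite -leqn0 leqNgt.
    by apply/negP => h; apply: nw; exists v; apply/finalP.
  exists (nwalk G k u w) => v ov.
  have ow := final_cell hG uV fw.
  have [vF|/negP vF] := boolP (v \in F); last first.
    rewrite mul0n; apply/eqP; rewrite -leqn0 leqNgt; apply/negP => h.
    by apply: vF; apply/mem_final => //; apply/finalP.
  rewrite mul1n -!ncard_dpaths//; apply: sym => //; exact/mem_final.
rewrite -sumF /kern_mean mulr_suml; rewrite big_seq [RHS]big_seq.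
have rE : (\sum_(w <- cell_fset o) nwalk G k u w)%:R = #|` F|%:R * m%:R :> R.
  rewrite natr_sum big_seq (eq_bigr (fun v => (v \in F)%:R * m%:R)).
    rewrite -big_seq (sumF (fun=> m%:R)) big_const_seq count_predT iter_addr_0.
    by rewrite -[_ *+ _]mulr_natl.
  by move=> v /(mem_cell_fset hG)/mE ->; rewrite natrM.
have : #|` F|%:R * m%:R != 0 :> R.
  by rewrite -rE pnatr_eq0 -lt0n row_gt0.
rewrite mulf_eq0 negb_or => /andP[F0 m0].
apply: eq_bigr => v /(mem_cell_fset hG)/mE vE.
rewrite /kern vE rE natrM /ncard -/F invfM.
rewrite [RHS]mulrAC; congr (_ * _); rewrite -mulrA; congr (_ * _).
by rewrite mulrCA mulfV// mulr1.
Qed.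

End kernel.

(** * Cost of the coupling *)

(** What is used of [min 1 t] and of [t^p] to measure the smallness of a
    distance: a triangle inequality up to the constant [c] suffices. *)
Record gauge (R : realType) (h : R -> R) (c : R) : Prop := Gauge {
  gauge_cst : 0 <= c ;
  gauge_ge0 : forall t, 0 <= t -> 0 <= h t ;
  gauge_homo : forall s t, 0 <= s -> s <= t -> h s <= h t ;
  gauge_add : forall s t, 0 <= s -> 0 <= t -> h (s + t) <= c * (h s + h t) }.

Lemma gauge_min1 (R : realType) : gauge (fun t : R => Num.min 1 t) 1.
Proof.
split => // [t t0|s t s0 st|s t s0 t0].
- by rewrite le_min ler01.
- by rewrite le_min ge_min lexx /= ge_min st orbT.
rewrite mul1r ge_min.
have [s1|s1] := leP 1 s; first by rewrite lerDl le_min ler01 t0.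
have [t1|t1] := leP 1 t; first by rewrite lerDr s0.
by rewrite lexx orbT.
Qed.

(** The sum [s + t] is at most twice the larger term. *)
Lemma gauge_powR (R : realType) (p : R) : 0 <= p ->
  gauge (fun t : R => t `^ p) (2 `^ p).
Proof.
move=> p0; split => [|t _|s t s0 st|s t s0 t0]; rewrite ?powR_ge0//.
  by rewrite ge0_ler_powR// nnegrE// (le_trans s0).
wlog st : s t s0 t0 / s <= t => [wl|].
  have [st|/ltW ts] := leP s t; first exact: wl.
  by rewrite addrC [s `^ p + _]addrC wl.
apply: (@le_trans _ _ ((2 * t) `^ p)).
  rewrite ge0_ler_powR// ?nnegrE ?mulr_ge0 ?addr_ge0//.
  by rewrite mulr_natl mulr2n lerD2r.
by rewrite powRM// ler_wpM2l ?powR_ge0// lerDr powR_ge0.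
Qed.

Section transport.
Variables (T : choiceType) (G : class_graph T) (hG : admissible G) (o : cls G).
Variables (R : realType) (F : metricType R) (f : T -> F).
Implicit Types (i : cls G) (u v : T).

(** The mean of [h] of the distance between the values of [f] at the two ends of
    the coupling between a uniform vertex of [i] and one of [o]. *)
Definition cost (h : R -> R) i : R :=
  avg i (fun u => kern_mean o u (fun v => h (mdist (f u) (f v)))).

Section bounds.
Variables (h : R -> R) (c : R) (hc : gauge h c) (x : F).
Let g u := h (mdist (f u) x).

(** This inequality and the next one are the triangle inequality through the
    coupling, read in the two directions. *)
Lemma avg_target_le i : avg o g <= c * (avg i g + cost h i).
Proof.
rewrite -(avg_kern hG o i) mulrDr -!avgZ -avgD; apply: le_avg => // u iu.
have uV := cell_vert hG iu.
rewrite -[c * g u](@kern_mean_cst _ _ hG o _ u)// -kern_meanZ -kern_meanD.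
apply: le_kern_mean => // v _; rewrite -mulrDr addrC.
apply: (le_trans _ (gauge_add hc _ _)); rewrite ?mdist_ge0//.
apply: (gauge_homo hc); rewrite ?mdist_ge0//.
by rewrite [mdist (f u) (f v)]metric_sym; apply: metric_triangle.
Qed.

Lemma avg_source_le i : avg i g <= c * (avg o g + cost h i).
Proof.
rewrite -(avg_kern hG o i) mulrDr -!avgZ -avgD; apply: le_avg => // u iu.
have uV := cell_vert hG iu.
rewrite -{1}[g u](@kern_mean_cst _ _ hG o _ u)// -!kern_meanZ -kern_meanD.
apply: le_kern_mean => // v _; rewrite -mulrDr addrC.
apply: (le_trans _ (gauge_add hc _ _)); rewrite ?mdist_ge0//.
by apply: (gauge_homo hc); rewrite ?mdist_ge0// metric_triangle.
Qed.

Lemma cost_eps_oo i : cost h i <= h (eps_oo o f i).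
Proof.
rewrite -[leRHS](avg_cst hG i); apply: le_avg => // u iu.
have uV := cell_vert hG iu.
rewrite -[leRHS](@kern_mean_cst _ _ hG o _ u)//; apply: le_kern_mean => // v fv.
apply: (gauge_homo hc); rewrite ?mdist_ge0// /eps_oo.
have uI : u \in fset_set (cell i) by apply/mem_cell_fset.
have vF : v \in fset_set (final o u) by apply/mem_final.
apply: (bigmax_sup_seq _ u) => //.
exact: (bigmax_sup_seq _ v).
Qed.

End bounds.

Lemma eps_ge0 i p : 0 <= eps o f i p.
Proof. exact: powR_ge0. Qed.

Lemma eps_oo_ge0 i : 0 <= eps_oo o f i.
Proof. exact: bigmax_ge_id. Qed.

Hypothesis sym : symmetry_condition o.

Lemma cost_pow i p : 1 <= p -> cost (fun t => t `^ p) i = eps o f i p `^ p.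
Proof.
move=> p1; have p0 : p != 0 by rewrite gt_eqF// (lt_le_trans ltr01).
rewrite /eps -powRrM mulVf// powRr1; last first.
  by apply: sumr_ge0 => u _; apply: sumr_ge0 => v _; rewrite divr_ge0// powR_ge0.
rewrite /cost /avg mulr_suml big_seq [RHS]big_seq; apply: eq_bigr => u.
move=> /(mem_cell_fset hG)/(cell_vert hG) uV; rewrite kern_mean_sym// -mulr_suml.
by rewrite invfM -mulrA [in LHS](mulrC (_^-1)).
Qed.

(** By concavity of [min 1], a bound in mean controls the truncated cost; this
    is why the exponent 1 suffices for convergence in probability. *)
Lemma cost_min1 i : cost (Num.min 1) i <= Num.min 1 (eps o f i 1).
Proof.
rewrite le_min; apply/andP; split.
  rewrite -[leRHS](avg_cst hG i); apply: le_avg => // u /(cell_vert hG) uV.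
  rewrite -[leRHS](@kern_mean_cst _ _ hG o _ u)//; apply: le_kern_mean => // v _.
  by rewrite ge_min lexx.
rewrite -[leRHS]powRr1 ?eps_ge0// -cost_pow//.
apply: le_avg => // u /(cell_vert hG) uV.
apply: le_kern_mean => // v _.
by rewrite powRr1 ?mdist_ge0// ge_min lexx orbT.
Qed.

End transport.

(** * Integrals of functions of an invariant random vertex *)

Lemma integral_const d (Omega : measurableType d) (R : realType)
    (P : probability Omega R) (a : R) : (\int[P]_w a%:E = a%:E)%E.
Proof.
rewrite -[RHS]mule1; etransitivity.
  exact: (integral_cst P measurableT a%:E).
by congr (_ * _)%E; exact: probability_setT.
Qed.

Section vertex.
Context d (Omega : measurableType d) (R : realType) (P : probability Omega R).
Variables (T : choiceType) (G : class_graph T) (hG : admissible G).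
Variables (X : Omega -> T).
Hypotheses (hX : random_vertex G X) (hinv : G_invariant P G X).
Implicit Types (g : T -> R) (i : cls G).

Lemma measurable_vertex d' (U : measurableType d') (g : T -> U) :
  measurable_fun setT (fun w => g (X w)).
Proof. by move=> _ B _; rewrite setTI; exact: (hX.2 (g @^-1` B)). Qed.

Let meas g D : measurable_fun D (fun w => (g (X w))%:E).
Proof.
apply: (@measurable_funS _ _ _ _ setT) => //.
exact: (@measurable_vertex _ (\bar R) (fun u => (g u)%:E)).
Qed.

(** The vertices of a cell have the same probability; taking [g = 1] in the sum
    over the cell identifies it as [P (X in i) / |i|]. *)
Lemma integral_cell g i : (forall u, 0 <= g u) ->
  (\int[P]_(w in X @^-1` cell i) (g (X w))%:E =
   (avg i g)%:E * P (X @^-1` cell i))%E.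
Proof.
move=> g0; have [u0 iu0] := cell_nonempty hG i.
set q := P (X @^-1` [set u0]).
have intE g' : (forall u, 0 <= g' u) ->
    (\int[P]_(w in X @^-1` cell i) (g' (X w))%:E =
     (\sum_(u <- cell_fset i) g' u)%:E * q)%E.
  move=> g'0.
  have -> : X @^-1` cell i = \big[setU/set0]_(u <- cell_fset i) (X @^-1` [set u]).
    rewrite -bigcup_seq; apply/seteqP; split => w /=.
      by move=> iw; exists (X w) => //=; apply/mem_cell_fset.
    by move=> [u /= /(mem_cell_fset hG) iu ->].
  rewrite ge0_integral_bigsetU//.
  - rewrite -sumEFin ge0_sume_distrl => [|u _]; last by rewrite lee_fin.
    rewrite big_seq [RHS]big_seq; apply: eq_bigr => u /(mem_cell_fset hG) iu.
    rewrite (eq_integral (cst (g' u)%:E)) => [|w /set_mem/= -> //].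
    rewrite integral_cst; last exact: hX.2.
    by congr (_ * _)%E; exact: hinv iu iu0.
  - by move=> u; exact: hX.2.
  - by move=> u v _ _ [w [/= <- <-]].
  - by move=> w _; rewrite lee_fin.
have PE : P (X @^-1` cell i) = ((size (cell_fset i))%:R%:E * q)%E.
  have := intE (fun=> 1) (fun=> ler01).
  rewrite (integral_cst P (hX.2 _) 1%E) mul1e => ->.
  by rewrite big_const_seq count_predT iter_addr_0.
rewrite intE// PE muleA -EFinM /avg divfK//.
by rewrite gt_eqF// size_cell_fset_gt0.
Qed.

(** The events that [X] lies in a given cell form a countable partition, indexed
    here by the codes of the cells. *)
Lemma le_integral_avg g g' : (forall u, 0 <= g u) -> (forall u, 0 <= g' u) ->
  (forall i, avg i g <= avg i g') ->
  (\int[P]_w (g (X w))%:E <= \int[P]_w (g' (X w))%:E)%E.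
Proof.
move=> g0 g'0 gg'.
pose D k := [set w | exists2 i : cls G, cell i (X w) & choice.pickle i = k].
have cupD : setT = \bigcup_k D k.
  apply/seteqP; split => // w _; have [i iw] := vert_cell hG (hX.1 w).
  by exists (choice.pickle i) => //; exists i.
have trivD : trivIset setT D.
  move=> k l _ _ [w [[i iw <-] [j jw <-]]].
  by rewrite (cell_inj hG iw jw).
have mD k : measurable (D k).
  exact: (hX.2 [set u | exists2 i : cls G, cell i u & choice.pickle i = k]).
rewrite cupD !ge0_integral_bigcup//; last 2 first.
- by move=> w _; rewrite lee_fin.
- by move=> w _; rewrite lee_fin.
apply: lee_nneseries => [k _ _|k _].
  by apply: integral_ge0 => w _; rewrite lee_fin.
have [[i ik]|nk] := pselect (exists i : cls G, choice.pickle i = k); last first.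
  have -> : D k = set0.
    by apply/seteqP; split => // w [i _ ik]; apply: nk; exists i.
  by rewrite !integral_set0.
have -> : D k = X @^-1` cell i.
  apply/seteqP; split => w /= => [[j jw jk]|iw]; last by exists i.
  by have <- : j = i by apply: (pcan_inj choice.pickleK); rewrite jk.
by rewrite !integral_cell// lee_wpmul2r// lee_fin.
Qed.

End vertex.

Section step.
Context d (Omega : measurableType d) (R : realType) (P : probability Omega R).
Variables (T : choiceType) (G : class_graph T) (hG : admissible G) (o : cls G).
Variables (F : metricType R) (f : T -> F) (h : R -> R) (c : R) (hc : gauge h c).
Variables (x : F) (Z : cls G -> R).
Hypotheses (Z0 : forall i, 0 <= Z i) (hZ : forall i, cost o f h i <= h (Z i)).
Variable X : Omega -> T.
Hypotheses (hX : random_vertex G X) (hinv : G_invariant P G X).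

Let a : R := avg o (fun u => h (mdist (f u) x)).

Lemma avg_gauge_ge0 : 0 <= avg o (fun u => h (mdist (f u) x)).
Proof. by apply: avg_ge0 => // u; rewrite (gauge_ge0 hc) ?mdist_ge0. Qed.

Let eZ := (\int[P]_w (h (Z (Class o (X w))))%:E)%E.
Let ef := (\int[P]_w (h (mdist (f (X w)) x))%:E)%E.

(** Integrated form of the triangle inequality through the coupling: the
    reference cell does not depend on the cell of [X], so that its average is a
    constant. This lemma bounds [f(X)] by the reference cell; the next one goes
    the other way. *)
Lemma integral_source_le : (ef <= c%:E * (a%:E + eZ))%E.
Proof.
have a0 : 0 <= a := avg_gauge_ge0.
have c0 := gauge_cst hc.
have hZ0 i : 0 <= h (Z i) by rewrite (gauge_ge0 hc).
have mE (g : T -> R) : measurable_fun setT (fun w => (g (X w))%:E).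
  exact: (measurable_vertex hX (U := \bar R) (fun u => (g u)%:E)).
apply: (@le_trans _ _ (\int[P]_w (c * (a + h (Z (Class o (X w)))))%:E)%E).
  apply: (le_integral_avg hG hX hinv (g := fun u => h (mdist (f u) x))
    (g' := fun u => c * (a + h (Z (Class o u))))).
  - by move=> u; rewrite (gauge_ge0 hc) ?mdist_ge0.
  - by move=> u; rewrite mulr_ge0// addr_ge0.
  move=> i; apply: (le_trans (avg_source_le hG o f hc x i)).
  rewrite (eq_avg hG (i := i) (g' := fun=> c * (a + h (Z i)))); last first.
    by move=> u iu; rewrite (Class_cellE hG o iu).
  by rewrite avg_cst// ler_wpM2l// lerD2l.
rewrite (eq_integral (fun w => c%:E * (a%:E + (h (Z (Class o (X w))))%:E))%E)//.
rewrite ge0_integralZl//; first last.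
- by move=> w _; rewrite -EFinD lee_fin addr_ge0.
- exact: (mE (fun u => a + h (Z (Class o u)))).
rewrite ge0_integralD//; first last.
- exact: (mE (fun u => h (Z (Class o u)))).
- by move=> w _; rewrite lee_fin.
by rewrite integral_const.
Qed.

Lemma avg_target_le_integral : (a%:E <= c%:E * (ef + eZ))%E.
Proof.
have a0 : 0 <= a := avg_gauge_ge0.
have c0 := gauge_cst hc.
have hZ0 i : 0 <= h (Z i) by rewrite (gauge_ge0 hc).
have hf0 u : 0 <= h (mdist (f u) x) by rewrite (gauge_ge0 hc) ?mdist_ge0.
have mE (g : T -> R) : measurable_fun setT (fun w => (g (X w))%:E).
  exact: (measurable_vertex hX (U := \bar R) (fun u => (g u)%:E)).
apply: (@le_trans _ _ (\int[P]_w
    (c * (h (mdist (f (X w)) x) + h (Z (Class o (X w)))))%:E)%E).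
  rewrite -[a%:E](integral_const P).
  apply: (le_integral_avg hG hX hinv (g := fun=> a)
    (g' := fun u => c * (h (mdist (f u) x) + h (Z (Class o u))))).
  - by move=> u; exact: a0.
  - by move=> u; rewrite mulr_ge0// addr_ge0.
  move=> i; rewrite avg_cst//; apply: (le_trans (avg_target_le hG o f hc x i)).
  rewrite avgZ avgD ler_wpM2l// lerD2l.
  rewrite (eq_avg hG (i := i) (g' := fun=> h (Z i))); first by rewrite avg_cst.
  by move=> u iu; rewrite (Class_cellE hG o iu).
rewrite (eq_integral (fun w => c%:E *
  ((h (mdist (f (X w)) x))%:E + (h (Z (Class o (X w))))%:E))%E)//.
rewrite ge0_integralZl//; first last.
- by move=> w _; rewrite -EFinD lee_fin addr_ge0.
- exact: (mE (fun u => h (mdist (f u) x) + h (Z (Class o u)))).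
rewrite ge0_integralD//; first by move=> w _; rewrite lee_fin.
- exact: (mE (fun u => h (mdist (f u) x))).
- by move=> w _; rewrite lee_fin.
- exact: (mE (fun u => h (Z (Class o u)))).
Qed.

End step.

(** * Modes of convergence as convergence of integrals *)

Lemma cvge0_le (R : realType) (u : nat -> \bar R) : (forall n, (0 <= u n)%E) ->
  (u n @[n --> \oo] --> (0 : \bar R)) <->
  (forall e : R, 0 < e -> \forall n \near \oo, (u n <= e%:E)%E).
Proof.
move=> u0; split=> [/fine_cvgP[ufin u_cvg] e e0|ule].
  have /cvgr0Pnorm_le/(_ e e0) ule := u_cvg.
  apply: (filterS2 _ _ ufin ule) => n un_fin /= une.
  by rewrite -(fineK un_fin) lee_fin (le_trans (ler_norm _)).
apply/fine_cvgP; split.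
  apply: (filterS _ (ule 1 ltr01)) => n un1.
  by rewrite ge0_fin_numE// (le_lt_trans un1)// ltry.
apply/cvgr0Pnorm_le => e e0; apply: (filterS _ (ule e e0)) => n /= une.
have ufin : u n \is a fin_num by rewrite ge0_fin_numE// (le_lt_trans une)// ltry.
by rewrite ger0_norm ?fine_ge0// -lee_fin fineK.
Qed.

Lemma nearT_gt0 : \forall n \near \oo, (0 < n)%N.
Proof. exact: nbhs_infty_gt. Qed.

Section modes.
Context d (Omega : measurableType d) (R : realType) (P : probability Omega R).
Variable Z : nat -> Omega -> R.
Hypothesis Z0 : forall n w, 0 <= Z n w.
Hypothesis mZ : forall n, (0 < n)%N -> measurable_fun setT (Z n).

(** [min 1 Z] is at most [e] plus the indicator of [Z > e], and at least
    [min 1 e] times that indicator. *)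
Lemma cvg0_probP : cvg0_prob P Z <->
  (\int[P]_w (Num.min 1 (Z n w))%:E)%E @[n --> \oo] --> (0 : \bar R).
Proof.
have min0 n w : 0 <= Num.min 1 (Z n w) by rewrite le_min ler01 Z0.
have int0 n : (0 <= \int[P]_w (Num.min 1 (Z n w))%:E)%E.
  by apply: integral_ge0 => w _; rewrite lee_fin.
have mmin n : (0 < n)%N ->
    measurable_fun setT (fun w => (Num.min 1 (Z n w))%:E).
  move=> n0; apply/measurable_EFinP; apply: measurable_minr => //; exact: mZ.
pose A e n := [set w | e < `|Z n w|].
have mA e n : (0 < n)%N -> measurable (A e n).
  move=> n0; have mN : measurable_fun setT (fun w => `|Z n w|).
    by apply: measurableT_comp => //; exact: mZ.
  have := mN measurableT _ (measurable_itv `]e, +oo[).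
  rewrite setTI; congr measurable.
  by apply/seteqP; split => w /=; rewrite in_itv/= andbT.
have mind e n : (0 < n)%N -> measurable_fun setT (\1_(A e n) : Omega -> R).
  by move=> n0; apply: measurable_indic; exact: mA.
split=> [cvgZ|/(cvge0_le int0) cvgZ].
  apply/(cvge0_le int0) => e e0; have e20 : 0 < e / 2 by rewrite divr_gt0.
  have PA :=
    (cvge0_le (fun n => measure_ge0 P (A (e / 2) n))).1 (cvgZ _ e20) _ e20.
  apply: (filterS2 _ _ nearT_gt0 PA) => n n0 PAn.
  apply: (@le_trans _ _ (\int[P]_w ((e / 2)%:E + (\1_(A (e / 2) n) w)%:E))%E).
    apply: ge0_le_integral => //.
    - by move=> w _; rewrite lee_fin.
    - exact: mmin.
    - by apply: emeasurable_funD => //; apply/measurable_EFinP; exact: mind.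
    move=> w _; rewrite -EFinD lee_fin indicE ge_min.
    have [wA|wA] := boolP (w \in A (e / 2) n); first by rewrite lerDr ltW.
    rewrite addr0; apply/orP; right; rewrite -(ger0_norm (Z0 n w)) leNgt.
    by apply: contra wA => ?; apply/mem_set.
  rewrite ge0_integralD//; first last.
  - by apply/measurable_EFinP; exact: mind.
  - by move=> w _; rewrite lee_fin ltW.
  rewrite integral_const integral_indic//; last exact: mA.
  by rewrite setIT [e in leRHS]splitr EFinD leeD2l.
move=> e e0; apply/cvge0_le => [n|r r0]; first exact: measure_ge0.
have m0 : 0 < Num.min 1 e by rewrite lt_min ltr01.
apply: (filterS2 _ _ nearT_gt0 (cvgZ _ (mulr_gt0 m0 r0))) => n n0 intle.
rewrite -(@lee_pmul2l _ (Num.min 1 e)%:E) ?lte_fin// -EFinM.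
apply: le_trans intle; rewrite -/(A e n) -[A e n]setIT.
rewrite -integral_indic//; last exact: mA.
rewrite -ge0_integralZl//; first last.
- by rewrite lee_fin ltW.
- by apply/measurable_EFinP; exact: mind.
apply: ge0_le_integral => //.
- by move=> w _; rewrite -EFinM lee_fin mulr_ge0// ltW.
- by apply: measurable_funeM; apply/measurable_EFinP; exact: mind.
- exact: mmin.
move=> w _; rewrite -EFinM lee_fin indicE.
have [/set_mem|wA] := boolP (w \in A e n); last by rewrite mulr0.
rewrite mulr1 /A /= ger0_norm// => eZ.
by rewrite le_min !ge_min lexx (ltW eZ) orbT.
Qed.

Lemma cvg0_LpP p : 0 < p -> cvg0_Lp P p Z <->
  (forall n, (0 < n)%N -> (\int[P]_w (Z n w `^ p)%:E < +oo)%E) /\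
  (\int[P]_w (Z n w `^ p)%:E)%E @[n --> \oo] --> (0 : \bar R).
Proof.
move=> p0; have pi0 : 0 < p^-1 by rewrite invr_gt0.
have NE n : ('N[P]_p%:E[EFin \o Z n] = (\int[P]_w (Z n w `^ p)%:E) `^ p^-1)%E.
  rewrite unlock; congr (_ `^ _)%E; apply: eq_integral => w _ /=.
  by rewrite ger0_norm.
have int0 n : (0 <= \int[P]_w (Z n w `^ p)%:E)%E.
  by apply: integral_ge0 => w _; rewrite lee_fin powR_ge0.
have N0 n : (0 <= 'N[P]_p%:E[EFin \o Z n])%E by exact: Lnorm_ge0.
have fin n : (0 < n)%N ->
    (Z n \in Lfun P p%:E) <-> (\int[P]_w (Z n w `^ p)%:E < +oo)%E.
  move=> n0; split.
    rewrite inE => /andP[_]; rewrite inE /= /finite_norm NE.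
    by apply: lty_poweRy; rewrite gt_eqF.
  move=> fin; rewrite inE; apply/andP; split; rewrite inE /=; first exact: mZ.
  by rewrite /finite_norm NE poweR_lty.
have le n e : 0 < e -> ('N[P]_p%:E[EFin \o Z n] <= e%:E)%E <->
    (\int[P]_w (Z n w `^ p)%:E <= (e `^ p)%:E)%E.
  move=> e0; rewrite NE; split => le_e.
    have := gt0_ler_poweR (ltW p0) _ _ le_e.
    rewrite -poweRrM mulVf ?gt_eqF// poweRe1//.
    by apply; rewrite in_itv /= leey andbT ?poweR_ge0// lee_fin ltW.
  have := gt0_ler_poweR (ltW pi0) _ _ le_e.
  rewrite poweR_EFin -powRrM mulfV ?gt_eqF// powRr1 ?(ltW e0)//.
  by apply; rewrite in_itv /= leey andbT// lee_fin powR_ge0.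
split=> -[Zfin cvgZ]; split.
- by move=> n n0; apply/fin => //; exact: Zfin.
- apply/cvge0_le => // e e0; have e'0 : 0 < e `^ p^-1 by rewrite powR_gt0.
  apply: (filterS _ ((cvge0_le N0).1 cvgZ _ e'0)) => n Nle.
  have := (le n _ e'0).1 Nle.
  by rewrite -powRrM mulVf ?gt_eqF// powRr1 ?(ltW e0)//.
- by move=> n n0; apply/fin => //; exact: Zfin.
apply/cvge0_le => // e e0; have e'0 : 0 < e `^ p by rewrite powR_gt0.
apply: (filterS _ ((cvge0_le int0).1 cvgZ _ e'0)) => n Nle.
exact: (le n _ e0).2 Nle.
Qed.

End modes.

(** * Transfer of convergence through the reference cell *)

Section transfer.
Context d (Omega : measurableType d) (R : realType) (P : probability Omega R).
Variables (T : choiceType) (G : nat -> class_graph T).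
Hypothesis hG : forall n, (0 < n)%N -> admissible (G n).
Variables (o : forall n, cls (G n)) (F : metricType R) (f : T -> F) (x : F).
Variables X Y : nat -> Omega -> T.
Hypothesis hX : forall n, (0 < n)%N ->
  random_vertex (G n) (X n) /\ G_invariant P (G n) (X n).
Hypothesis hY : forall n, (0 < n)%N ->
  random_vertex (G n) (Y n) /\ G_invariant P (G n) (Y n).
Variables (h : R -> R) (c : R) (hc : gauge h c).
Variable E : forall n, cls (G n) -> R.
Hypothesis E0 : forall n i, 0 <= E (n := n) i.
Hypothesis hE : forall n, (0 < n)%N -> forall i, cost (o n) f h i <= h (E i).

Let dist (X : nat -> Omega -> T) n :=
  (\int[P]_w (h (mdist (f (X n w)) x))%:E)%E.
Let discr (X : nat -> Omega -> T) n :=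
  (\int[P]_w (h (E (Class (o n) (X n w))))%:E)%E.

(** Besides the convergence of the norms, convergence in L^p asks that all terms
    lie in L^p; the average over the reference cell, a finite sum, is no
    obstacle. *)
Lemma gauge_integral_lty : (forall n, (0 < n)%N -> (discr X n < +oo)%E) ->
  forall n, (0 < n)%N -> (dist X n < +oo)%E.
Proof.
move=> fin n n0; have [rX iX] := hX n0.
apply: (le_lt_trans (integral_source_le (hG n0) hc x (@E0 n) (hE n0) rX iX)).
have d0 : (0 <= discr X n)%E.
  by apply: integral_ge0 => w _; rewrite lee_fin (gauge_ge0 hc).
have dfin : discr X n \is a fin_num by rewrite (ge0_fin_numE d0) fin.
rewrite -/(discr X n) -(fineK dfin).
by rewrite -EFinD -EFinM ltry.
Qed.

(** Through the average over the reference cell: [Y] bounds that average, which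
    bounds [X]. *)
Lemma gauge_integral_cvg :
  dist Y n @[n --> \oo] --> (0 : \bar R) ->
  discr Y n @[n --> \oo] --> (0 : \bar R) ->
  discr X n @[n --> \oo] --> (0 : \bar R) ->
  dist X n @[n --> \oo] --> (0 : \bar R).
Proof.
move=> distY discrY discrX.
have c0 := gauge_cst hc.
apply: (@squeeze_cvge _ _ _ _ (fun=> 0%E) _
  (fun n => c%:E * (c%:E * (dist Y n + discr Y n) + discr X n))%E).
- apply: (filterS _ nearT_gt0) => n n0.
  have [[rX iX] [rY iY]] := (hX n0, hY n0).
  apply/andP; split.
    by apply: integral_ge0 => w _; rewrite lee_fin (gauge_ge0 hc) ?mdist_ge0.
  apply: (le_trans (integral_source_le (hG n0) hc x (@E0 n) (hE n0) rX iX)).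
  rewrite lee_wpmul2l ?lee_fin// leeD2r//.
  exact: (avg_target_le_integral (hG n0) hc x (@E0 n) (hE n0) rY iY).
- exact: cvg_cst.
have -> : 0%E = (c%:E * (c%:E * (0 + 0) + 0))%E :> \bar R.
  by rewrite !adde0 !mule0.
apply: cvgeZl => //; apply: cvgeD => //; apply: cvgeZl => //; exact: cvgeD.
Qed.

End transfer.

Section vertex_modes.
Context d (Omega : measurableType d) (R : realType) (P : probability Omega R).
Variables (T : choiceType) (G : nat -> class_graph T) (X : nat -> Omega -> T).
Hypothesis hX : forall n, (0 < n)%N ->
  random_vertex (G n) (X n) /\ G_invariant P (G n) (X n).
Variables (g : nat -> T -> R) (g0 : forall n u, 0 <= g n u).

Lemma measurable_vertices n : (0 < n)%N ->
  measurable_fun setT (fun w => g n (X n w)).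
Proof.
by move=> n0; have [rX _] := hX n0; exact: (measurable_vertex rX (g n)).
Qed.

Lemma cvg0_prob_vertexP : cvg0_prob P (fun n w => g n (X n w)) <->
  (\int[P]_w (Num.min 1 (g n (X n w)))%:E)%E @[n --> \oo] --> (0 : \bar R).
Proof. exact: (cvg0_probP P (fun n w => g0 n _) measurable_vertices). Qed.

Lemma cvg0_Lp_vertexP p : 0 < p -> cvg0_Lp P p (fun n w => g n (X n w)) <->
  (forall n, (0 < n)%N -> (\int[P]_w (g n (X n w) `^ p)%:E < +oo)%E) /\
  (\int[P]_w (g n (X n w) `^ p)%:E)%E @[n --> \oo] --> (0 : \bar R).
Proof. exact: (cvg0_LpP P (fun n w => g0 n _) measurable_vertices). Qed.

End vertex_modes.

Section modes_transfer.
Context d (Omega : measurableType d) (R : realType) (P : probability Omega R).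
Variables (T : choiceType) (G : nat -> class_graph T).
Hypothesis hG : forall n, (0 < n)%N -> admissible (G n).
Variables (o : forall n, cls (G n)) (F : metricType R) (f : T -> F) (x : F).
Variables X Y : nat -> Omega -> T.
Hypothesis hX : forall n, (0 < n)%N ->
  random_vertex (G n) (X n) /\ G_invariant P (G n) (X n).
Hypothesis hY : forall n, (0 < n)%N ->
  random_vertex (G n) (Y n) /\ G_invariant P (G n) (Y n).
Variable E : forall n, cls (G n) -> R.
Hypothesis E0 : forall n i, 0 <= E (n := n) i.

Let phi (_ : nat) u := mdist (f u) x.
Let discr n u := E (Class (o n) u).
Let phi0 n u : 0 <= phi n u. Proof. exact: mdist_ge0. Qed.
Let discr0 n u : 0 <= discr n u. Proof. exact: E0. Qed.

Lemma cvg_prob_transfer :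
  (forall n, (0 < n)%N -> forall i,
     cost (o n) f (Num.min 1) i <= Num.min 1 (E i)) ->
  cvg_prob P (fun n w => f (Y n w)) x ->
  cvg0_prob P (fun n w => E (Class (o n) (Y n w))) ->
  cvg0_prob P (fun n w => E (Class (o n) (X n w))) ->
  cvg_prob P (fun n w => f (X n w)) x.
Proof.
move=> hE /(cvg0_prob_vertexP hY phi0) distY.
move=> /(cvg0_prob_vertexP hY discr0) discrY.
move=> /(cvg0_prob_vertexP hX discr0) discrX; apply/(cvg0_prob_vertexP hX phi0).
exact: (gauge_integral_cvg hG hX hY (gauge_min1 R) E0 hE distY discrY discrX).
Qed.

Lemma cvg_Lp_transfer p : 0 < p ->
  (forall n, (0 < n)%N -> forall i,
     cost (o n) f (fun t => t `^ p) i <= E i `^ p) ->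
  cvg_Lp P p (fun n w => f (Y n w)) x ->
  cvg0_Lp P p (fun n w => E (Class (o n) (Y n w))) ->
  cvg0_Lp P p (fun n w => E (Class (o n) (X n w))) ->
  cvg_Lp P p (fun n w => f (X n w)) x.
Proof.
move=> p0 hE /(cvg0_Lp_vertexP hY phi0 p0)[_ distY].
move=> /(cvg0_Lp_vertexP hY discr0 p0)[_ discrY].
move=> /(cvg0_Lp_vertexP hX discr0 p0)[finX discrX].
have hc := gauge_powR (ltW p0).
apply/(cvg0_Lp_vertexP hX phi0 p0); split.
  exact: (gauge_integral_lty hG x hX hc E0 hE finX).
exact: (gauge_integral_cvg hG hX hY hc E0 hE distY discrY discrX).
Qed.

End modes_transfer.

Unset Implicit Arguments.

Theorem theorem42 (R : realType) (d : measure_display)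
  (Omega : measurableType d) (P : probability Omega R)
  (T : choiceType) (G : nat -> class_graph T)
  (hG : forall n : nat, (0 < n)%N -> admissible (G n))
  (istar : forall n : nat, cls (G n))
  (F : metricType R) (f : T -> F)
  (sigma sigma_ref : nat -> Omega -> T)
  (hsigma : forall n : nat, (0 < n)%N ->
    random_vertex (G n) (sigma n) /\ G_invariant P (G n) (sigma n))
  (hsigma_ref : forall n : nat, (0 < n)%N ->
    random_vertex (G n) (sigma_ref n) /\ G_invariant P (G n) (sigma_ref n))
  (p : R) (hp : 1 <= p) (x : F) :
  (cvg_prob P (fun n w => f (sigma_ref n w)) x ->
   cvg0_prob P (fun n w => eps_oo (istar n) f (Class (istar n) (sigma_ref n w))) ->
   cvg0_prob P (fun n w => eps_oo (istar n) f (Class (istar n) (sigma n w))) ->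
   cvg_prob P (fun n w => f (sigma n w)) x) /\
  (cvg_Lp P p (fun n w => f (sigma_ref n w)) x ->
   cvg0_Lp P p (fun n w => eps_oo (istar n) f (Class (istar n) (sigma_ref n w))) ->
   cvg0_Lp P p (fun n w => eps_oo (istar n) f (Class (istar n) (sigma n w))) ->
   cvg_Lp P p (fun n w => f (sigma n w)) x) /\
  ((forall n : nat, (0 < n)%N -> symmetry_condition (istar n)) ->
   (cvg_prob P (fun n w => f (sigma_ref n w)) x ->
    cvg0_prob P (fun n w => eps (istar n) f (Class (istar n) (sigma_ref n w)) 1) ->
    cvg0_prob P (fun n w => eps (istar n) f (Class (istar n) (sigma n w)) 1) ->
    cvg_prob P (fun n w => f (sigma n w)) x) /\
   (cvg_Lp P p (fun n w => f (sigma_ref n w)) x ->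
    cvg0_Lp P p (fun n w => eps (istar n) f (Class (istar n) (sigma_ref n w)) p) ->
    cvg0_Lp P p (fun n w => eps (istar n) f (Class (istar n) (sigma n w)) p) ->
    cvg_Lp P p (fun n w => f (sigma n w)) x)).
Proof.
have p0 : 0 < p by rewrite (lt_le_trans ltr01).
have oo0 n i : 0 <= eps_oo (istar n) f i := eps_oo_ge0 _ f i.
have eps0 q n i : 0 <= eps (istar n) f i q := eps_ge0 _ f i q.
split; [|split; [|move=> sym; split]].
- apply: (cvg_prob_transfer hG hsigma hsigma_ref oo0) => n n0 i.
  exact: (cost_eps_oo (hG n n0) _ f (gauge_min1 R)).
- apply: (cvg_Lp_transfer hG hsigma hsigma_ref oo0 p0) => n n0 i.
  exact: (cost_eps_oo (hG n n0) _ f (gauge_powR (ltW p0))).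
- apply: (cvg_prob_transfer hG hsigma hsigma_ref (eps0 1)) => n n0 i.
  exact: (cost_min1 (hG n n0) f (sym n n0)).
- apply: (cvg_Lp_transfer hG hsigma hsigma_ref (eps0 p) p0) => n n0 i.
  by rewrite (cost_pow (hG n n0) f (sym n n0)).
Qed.
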